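(* Let $\alpha=(\alpha_n)_{n\in\mathbb{N}}$ be a sequence with $\alpha_n\uparrow\infty$. The following assertions are equivalent. (i) $0\notin\sigma(\mathsf{C};\Lambda_0(\alpha))$. (ii) For each $k\in\mathbb{N}$ there exists $l\in\mathbb{N}$ with $l>k$ such that $\sup_{n\in\mathbb{N}}\left(\log(n)-\left(\frac1k-\frac1l\right)\alpha_n\right)<\infty$. (iii) $\Lambda_0(\alpha)$ is nuclear.
   Context: Notation: $\mathbb{N}=\{1,2,3,\ldots\}$. The notation $\alpha_n\uparrow\infty$ means that $\alpha=(\alpha_n)_{n\in\mathbb{N}}\subseteq(1,\infty)$ satisfies $\alpha_n<\alpha_{n+1}$ for all $n\in\mathbb{N}$ and $\lim_{n\to\infty}\alpha_n=\infty$. For $k,n\in\mathbb{N}$ put $w_k(n):=e^{-\alpha_n/k}$. The power series space of finite type is $\Lambda_0(\alpha):=\{x\in\mathbb{C}^{\mathbb{N}}\colon \lim_{n\to\infty}w_k(n)|x_n|=0 \text{ for all } k\in\mathbb{N}\}$, a Fréchet space for the topology generated by the increasing sequence of norms $p_k(x):=\sup_{n\in\mathbb{N}}w_k(n)|x_n|$, $k\in\mathbb{N}$. The discrete Cesàro operator is $\mathsf{C}x:=\left(x_1,\frac{x_1+x_2}{2},\ldots,\frac{x_1+\cdots+x_n}{n},\ldots\right)$ for $x\in\mathbb{C}^{\mathbb{N}}$; it maps $\Lambda_0(\alpha)$ continuously into itself. For a locally convex Hausdorff space $X$, $\mathcal{L}(X)$ is the space of continuous linear operators from $X$ into itself; for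 $T\in\mathcal{L}(X)$ the resolvent set $\rho(T;X)$ consists of all $\lambda\in\mathbb{C}$ such that $(\lambda I-T)^{-1}$ exists in $\mathcal{L}(X)$, and the spectrum is $\sigma(T;X):=\mathbb{C}\setminus\rho(T;X)$. *)

(* Defs.v *)
From HB Require Import structures.
From mathcomp Require Import all_boot all_order all_algebra.
From mathcomp Require Import complex.
From mathcomp Require Import all_classical all_reals all_analysis.
From mathcomp Require Import ring lra.

Set Implicit Arguments.
Unset Strict Implicit.
Unset Printing Implicit Defensive.

Import Order.TTheory GRing.Theory Num.Theory.
Import numFieldNormedType.Exports.
Import Normc.

Local Open Scope classical_set_scope.
Local Open Scope complex_scope.
Local Open Scope ring_scope.

Section LocallyConvex.
Variable R : realType.
Local Notation C := (R[i]).

Definition resolvent_set (X : tvsType C) (T : X -> X) : set C :=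
  [set lambda | exists S : {linear X -> X},
    [/\ continuous S,
        (forall x, S (lambda *: x - T x) = x) &
        (forall x, lambda *: S x - T (S x) = x)]].

Definition spectrum (X : tvsType C) (T : X -> X) : set C :=
  ~` resolvent_set T.

Definition seminorm (X : lmodType C) (p : X -> R) : Prop :=
  (forall x y, p (x + y) <= p x + p y) /\
  (forall (a : C) x, p (a *: x) = normc a * p x).

(** The local Banach space of a seminorm [p] on [X], i.e. the completion of
    the normed space [X / ker p], given up to isometric isomorphism: a Banach
    space with a linear map from [X] that carries [p] to the norm and has
    dense range. *)
Record localBanach (X : lmodType C) (p : X -> R) := LocalBanach {
  localBanach_sort :> completeNormedModType C;
  localBanach_map : {linear X -> localBanach_sort};
  localBanach_norm : forall x, `|localBanach_map x| = (p x)%:C;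
  localBanach_dense : dense (range localBanach_map) }.

(** [T = \sum_i c_i f_i (.) y_i] with [\sum_i |c_i| < oo], [f_i] in the unit
    ball of the dual of [E], and [y_i] in the unit ball of [F]. *)
Definition nuclear_map (E F : normedModType C) (T : E -> F) : Prop :=
  exists (c : nat -> C) (f : nat -> {linear E -> C^o}) (y : nat -> F),
    [/\ cvgn (series (fun i => normc (c i))),
        (forall i x, `|f i x| <= `|x|),
        (forall i, `|y i| <= 1) &
        (forall x, series (fun i => (c i * f i x) *: y i) @ \oo --> T x)].

Definition nuclear_space (X : tvsType C) : Prop :=
  forall p : X -> R, seminorm p -> continuous p ->
  exists q : X -> R,
    [/\ seminorm q, continuous q, (forall x, p x <= q x) &
    exists (Xp : localBanach p) (Xq : localBanach q) (T : {linear Xq -> Xp}),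
      [/\ continuous T,
          (forall x, T (localBanach_map Xq x) = localBanach_map Xp x) &
          nuclear_map T]].

End LocallyConvex.

(** Sequences are indexed by [nat]: [alpha n] and [x n] stand for the terms of
    index [n + 1] of the sequences indexed by {1, 2, 3, ...}.  The parameter
    [k] of the weights is not shifted, hence the conditions [0 < k]. *)

Section PowerSeriesSpace.
Variable R : realType.
Local Notation C := (R[i]).
Implicit Types alpha : nat -> R.

Definition increasing_to_infty alpha : Prop :=
  [/\ (forall n, 1 < alpha n), (forall n, alpha n < alpha n.+1) &
      alpha n @[n --> \oo] --> +oo].

Definition weight alpha (k n : nat) : R := expR (- alpha n / k%:R).

Definition Lambda0_pred alpha : {pred nat -> C} :=
  [pred x : nat -> C | `[< forall k, (0 < k)%N ->
     weight alpha k n * normc (x n) @[n --> \oo] --> (0 : R) >]].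

Lemma weight_ge0 alpha k n : 0 <= weight alpha k n.
Proof. exact: expR_ge0. Qed.

Lemma normc_ge0 (z : C) : 0 <= normc z.
Proof. by case: z => a b /=; exact: sqrtr_ge0. Qed.

Lemma Lambda0_submod alpha : submod_closed (Lambda0_pred alpha).
Proof.
split=> [|a x y].
  apply/asboolP => k k0.
  rewrite (_ : (fun n => _) = fun=> 0); first exact: cvg_cst.
  by apply/funext => n; rewrite normc0 mulr0.
move=> /asboolP hx /asboolP hy; apply/asboolP => k k0.
apply: (@squeeze_cvgr _ _ _ _ (fun=> 0)
   (fun n => normc a * (weight alpha k n * normc (x n)) +
             weight alpha k n * normc (y n))).
- apply: nearW => n; rewrite mulr_ge0 ?weight_ge0 ?normc_ge0//=.
  rewrite mulrCA -mulrDr ler_wpM2l ?weight_ge0//.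
  by rewrite -normcM; exact: le_normcD.
- exact: cvg_cst.
- rewrite -[X in _ --> X]addr0 -[X in X + _](mulr0 (normc a)).
  by apply: cvgD; [apply: cvgMr; exact: hx|exact: hy].
Qed.

HB.instance Definition _ alpha :=
  GRing.isSubmodClosed.Build _ _ (Lambda0_pred alpha) (Lambda0_submod alpha).

Record Lambda0 alpha := MkLambda0 {
  Lambda0_seq :> nat -> C;
  _ : Lambda0_seq \in Lambda0_pred alpha }.

HB.instance Definition _ alpha := [isSub for @Lambda0_seq alpha].
HB.instance Definition _ alpha := [Choice of Lambda0 alpha by <:].
HB.instance Definition _ alpha :=
  [SubChoice_isSubLmodule of Lambda0 alpha by <:].

Definition Lambda0_norm alpha (k : nat) (x : Lambda0 alpha) : R :=
  sup (range (fun n => weight alpha k n * normc (x n))).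

Lemma Lambda0P alpha (x : Lambda0 alpha) k : (0 < k)%N ->
  weight alpha k n * normc (x n) @[n --> \oo] --> (0 : R).
Proof. by case: x => x /= /asboolP; apply. Qed.

Lemma Lambda0_norm_has_sup alpha k (x : Lambda0 alpha) : (0 < k)%N ->
  has_sup (range (fun n => weight alpha k n * normc (x n))).
Proof.
move=> k0; apply: cvg_has_sup; apply/cvg_ex; exists 0.
exact: (Lambda0P x k0).
Qed.

Lemma Lambda0_norm_ub alpha k (x : Lambda0 alpha) n : (0 < k)%N ->
  weight alpha k n * normc (x n) <= Lambda0_norm k x.
Proof.
move=> k0; apply: ub_le_sup; last by exists n.
by have [] := Lambda0_norm_has_sup x k0.
Qed.

Lemma Lambda0_norm_le alpha k (x : Lambda0 alpha) M :
  (forall n, weight alpha k n * normc (x n) <= M) -> Lambda0_norm k x <= M.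
Proof.
move=> h; apply: ge_sup.
  by exists (weight alpha k 0 * normc (x 0)); exists 0%N.
by move=> _ [n _ <-].
Qed.

Lemma Lambda0_norm_ge0 alpha k (x : Lambda0 alpha) : (0 < k)%N ->
  0 <= Lambda0_norm k x.
Proof.
move=> k0; apply: le_trans (Lambda0_norm_ub x 0 k0).
by rewrite mulr_ge0 ?weight_ge0 ?normc_ge0.
Qed.

Lemma Lambda0_normD alpha k (x y : Lambda0 alpha) : (0 < k)%N ->
  Lambda0_norm k (x + y) <= Lambda0_norm k x + Lambda0_norm k y.
Proof.
move=> k0; apply: Lambda0_norm_le => n.
apply: le_trans (lerD (Lambda0_norm_ub x n k0) (Lambda0_norm_ub y n k0)).
by rewrite -mulrDr ler_wpM2l ?weight_ge0//; exact: le_normcD.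
Qed.

Lemma Lambda0_norm_leZ alpha k (a : C) (x : Lambda0 alpha) : (0 < k)%N ->
  Lambda0_norm k (a *: x) <= normc a * Lambda0_norm k x.
Proof.
move=> k0; apply: Lambda0_norm_le => n.
apply: le_trans (ler_wpM2l (normc_ge0 a) (Lambda0_norm_ub x n k0)).
by rewrite mulrCA ler_wpM2l ?weight_ge0// -normcM.
Qed.

Lemma Lambda0_norm0 alpha k : (0 < k)%N -> Lambda0_norm k (0 : Lambda0 alpha) = 0.
Proof.
move=> k0; apply/eqP; rewrite eq_le Lambda0_norm_ge0// andbT.
by apply: Lambda0_norm_le => n; rewrite normc0 mulr0.
Qed.

Lemma Lambda0_normB alpha k (x y : Lambda0 alpha) : (0 < k)%N ->
  Lambda0_norm k (x - y) = Lambda0_norm k (y - x).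
Proof.
suff h (u v : Lambda0 alpha) : (0 < k)%N ->
    Lambda0_norm k (u - v) <= Lambda0_norm k (v - u).
  by move=> k0; apply/eqP; rewrite eq_le !h.
move=> k0; rewrite -opprB -scaleN1r.
apply: le_trans (Lambda0_norm_leZ _ _ k0) _.
by rewrite normcN normc1 mul1r.
Qed.

(** The topology generated by the norms [Lambda0_norm k], [k >= 1]: basic
    neighbourhoods bound finitely many of these norms. *)
Definition Lambda0_ball alpha (x : Lambda0 alpha) (N : nat) (e : R) :
    set (Lambda0 alpha) :=
  [set y | forall k, (0 < k <= N)%N -> Lambda0_norm k (y - x) < e].

Definition Lambda0_open alpha : set_system (Lambda0 alpha) :=
  [set U | forall x, U x ->
     exists N e, 0 < e /\ Lambda0_ball x N e `<=` U].

Lemma Lambda0_openT alpha : @Lambda0_open alpha setT.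
Proof. by move=> x _; exists 0%N, 1. Qed.

Lemma Lambda0_openI alpha : setI_closed (@Lambda0_open alpha).
Proof.
move=> U V oU oV x [/oU[N [e [e0 hU]]] /oV[M [d [d0 hV]]]].
exists (maxn N M), (Num.min e d); split; first by rewrite lt_min e0 d0.
move=> y hy; split.
  apply: hU => k /andP[k0 kN]; have /hy : (0 < k <= maxn N M)%N.
    by rewrite k0 leq_max kN.
  by rewrite lt_min => /andP[].
apply: hV => k /andP[k0 kN]; have /hy : (0 < k <= maxn N M)%N.
  by rewrite k0 leq_max kN orbT.
by rewrite lt_min => /andP[].
Qed.

Lemma Lambda0_open_bigU alpha (I : Type) (f : I -> set (Lambda0 alpha)) :
  (forall i, Lambda0_open (f i)) -> Lambda0_open (\bigcup_i f i).
Proof.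
move=> hf x [i _ /hf[N [e [e0 h]]]]; exists N, e; split => //.
by move=> y /h; exists i.
Qed.

HB.instance Definition _ alpha := isOpenTopological.Build (Lambda0 alpha)
  (@Lambda0_openT alpha) (@Lambda0_openI alpha) (@Lambda0_open_bigU alpha).

Lemma Lambda0_ball_center alpha (x : Lambda0 alpha) N e : 0 < e ->
  Lambda0_ball x N e x.
Proof. by move=> e0 k /andP[k0 _]; rewrite subrr Lambda0_norm0. Qed.

Lemma Lambda0_ball_open alpha (x : Lambda0 alpha) N e :
  open (Lambda0_ball x N e).
Proof.
suff : Lambda0_open (Lambda0_ball x N e) by [].
elim: N => [|N IHN] y hy; first by exists 0%N, 1; split => // z _ [].
have /IHN[M [d [d0 hM]]] : Lambda0_ball x N e y.
  by move=> k /andP[k0 kN]; apply: hy; rewrite k0 leqW.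
have hN : Lambda0_norm N.+1 (y - x) < e by apply: hy; rewrite leqnn.
exists (maxn M N.+1), (Num.min d (e - Lambda0_norm N.+1 (y - x))).
rewrite lt_min d0 subr_gt0; split => // z hz k /andP[k0].
rewrite leq_eqVlt => /orP[/eqP -> {k k0}|kN]; last first.
  apply: (hM z) => [j /andP[j0 jM]|]; last by rewrite k0.
  have /hz : (0 < j <= maxn M N.+1)%N by rewrite j0 leq_max jM.
  by rewrite lt_min => /andP[].
have /hz : (0 < N.+1 <= maxn M N.+1)%N by rewrite leq_max leqnn orbT.
rewrite lt_min ltrBrDr => /andP[_]; apply: le_lt_trans.
rewrite -[z - x](_ : (z - y) + (y - x) = _); first exact: Lambda0_normD.
by rewrite addrA subrK.
Qed.

Lemma Lambda0_nbhsP alpha (x : Lambda0 alpha) (A : set (Lambda0 alpha)) :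
  nbhs x A <-> exists N e, 0 < e /\ Lambda0_ball x N e `<=` A.
Proof.
split=> [[U [oU Ux UA]]|[N [e [e0 h]]]].
  by have [N [e [e0 h]]] := oU x Ux; exists N, e; split => // y /h/UA.
exists (Lambda0_ball x N e); split => //; last exact: Lambda0_ball_center.
exact: Lambda0_ball_open.
Qed.

Lemma Lambda0_add_continuous alpha :
  continuous (fun x : Lambda0 alpha * Lambda0 alpha => x.1 + x.2).
Proof.
move=> [x y] A /= /Lambda0_nbhsP[N [e [e0 h]]].
exists (Lambda0_ball x N (e / 2), Lambda0_ball y N (e / 2)) => /=.
  by split; apply/Lambda0_nbhsP; exists N, (e / 2); split => //; rewrite divr_gt0.
move=> [u v] /= [hu hv]; apply: h => k kN.
have k0 : (0 < k)%N by case/andP: kN.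
rewrite opprD addrACA (splitr e).
by apply: le_lt_trans (Lambda0_normD _ _ k0) _; rewrite ltrD ?hu ?hv.
Qed.

Lemma Lambda0_scale_continuous alpha :
  continuous (fun z : C^o * Lambda0 alpha => z.1 *: z.2).
Proof.
move=> [a x] A /= /Lambda0_nbhsP[N [e [e0 h]]].
pose M := \sum_(k < N.+1 | (0 < k)%N) Lambda0_norm k x.
have M0 : 0 <= M by apply: sumr_ge0 => k k0; exact: Lambda0_norm_ge0.
have D0 : 0 < normc a + 1 + M + 1 by have := normc_ge0 a; lra.
pose d := Num.min 1 (e / (normc a + 1 + M + 1)).
have d0 : 0 < d by rewrite lt_min ltr01 divr_gt0.
have d1 : d <= 1 by rewrite ge_min lexx.
have de : d * (normc a + 1 + M + 1) <= e.
  by rewrite -ler_pdivlMr// ge_min lexx orbT.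
exists ([set b : C | normc (b - a) < d], Lambda0_ball x N d) => /=.
  split; last by apply/Lambda0_nbhsP; exists N, d; split.
  apply/nbhs_ballP; exists d%:C => /=; first by rewrite ltcR.
  move=> b /=; rewrite -ball_normE /= => hb.
  by rewrite -normcN opprB -ltcR.
move=> [b y] /= [hb hy]; apply: h => k kN.
have k0 : (0 < k)%N by case/andP: kN.
rewrite -[b *: y - a *: x](_ : b *: (y - x) + (b - a) *: x = _); last first.
  by rewrite scalerBr scalerBl addrA subrK.
apply: le_lt_trans (Lambda0_normD _ _ k0) _.
have hk := hy k kN.
have hM : Lambda0_norm k x <= M.
  have kN' : (k < N.+1)%N by case/andP: kN.
  rewrite /M (bigD1 (Ordinal kN'))//= lerDl.
  by apply: sumr_ge0 => i /andP[i0 _]; exact: Lambda0_norm_ge0.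
have bb : normc b <= normc a + 1.
  rewrite -[b](subrK a) addrC; apply: le_trans (le_normcD _ _) _.
  by rewrite lerD2l ltW// (lt_le_trans hb).
have := Lambda0_norm_leZ b (y - x) k0.
have := Lambda0_norm_leZ (b - a) x k0.
have := Lambda0_norm_ge0 x k0.
have := Lambda0_norm_ge0 (y - x) k0.
have := normc_ge0 a; have := normc_ge0 b; have := normc_ge0 (b - a).
move: hb hk hM bb de d0 M0; nra.
Qed.

Lemma Lambda0_locally_convex alpha :
  exists2 B : set_system (Lambda0 alpha),
    (forall b, b \in B -> convex_set b) & basis B.
Proof.
exists [set b | exists x N e, 0 < e /\ b = Lambda0_ball x N e]; last first.
  split=> [_ [x [N [e [e0 ->]]]]|x A /Lambda0_nbhsP[N [e [e0 h]]]].
    exact: Lambda0_ball_open.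
  exists (Lambda0_ball x N e) => //; split; first by exists x, N, e.
  exact: Lambda0_ball_center.
move=> b; rewrite inE => -[x [N [e [e0 ->]]]] u v l; rewrite !inE => hu hv k kN.
have k0 : (0 < k)%N by case/andP: kN.
pose t := normc l%:num.
have t0 : 0 <= t by exact: normc_ge0.
have lt : l%:num = t%:C by rewrite -[LHS]ger0_norm.
have t1 : t <= 1 by rewrite -lecR -lt; exact: le1.
have nl : normc ((1 - l%:num)) = 1 - t.
  rewrite lt -(rmorph1 (real_complex R)) -rmorphB /= expr0n addr0 sqrtr_sqr ger0_norm//.
  by rewrite subr_ge0.
rewrite -[_ - x](_ : l%:num *: (u - x) + (1 - l%:num) *: (v - x) = _); last first.
  rewrite !scalerBr addrACA -opprD -scalerDl.
  by rewrite subrKC scale1r.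
apply: le_lt_trans (Lambda0_normD _ _ k0) _.
apply: le_lt_trans (lerD (Lambda0_norm_leZ _ _ k0) (Lambda0_norm_leZ _ _ k0)) _.
rewrite nl -/t; have [hu' hv'] := (hu k kN, hv k kN).
have hM : Num.max (Lambda0_norm k (u - x)) (Lambda0_norm k (v - x)) < e.
  by rewrite gt_max hu' hv'.
apply: le_lt_trans hM; set M := Num.max _ _.
rewrite -[leRHS]mul1r -[X in X * M](subrKC t) [leRHS]mulrDl.
by rewrite lerD// ler_wpM2l ?subr_ge0// le_max lexx ?orbT.
Qed.

(** This factory of the library only provides the uniform structure. *)
HB.instance Definition _ alpha := PreTopologicalLmod_isTvs.Build C (Lambda0 alpha)
  (@Lambda0_add_continuous alpha) (@Lambda0_scale_continuous alpha)
  (@Lambda0_locally_convex alpha).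
HB.instance Definition _ alpha :=
  PreTopologicalNmodule_isTopologicalNmodule.Build (Lambda0 alpha)
    (@Lambda0_add_continuous alpha).
HB.instance Definition _ alpha :=
  TopologicalNmodule_isTopologicalLmodule.Build C (Lambda0 alpha)
    (@Lambda0_scale_continuous alpha).
HB.instance Definition _ alpha :=
  Uniform_isTvs.Build C (Lambda0 alpha) (@Lambda0_locally_convex alpha).

Lemma weight_homo alpha k m n : increasing_to_infty alpha -> (m <= n)%N ->
  weight alpha k n <= weight alpha k m.
Proof.
move=> [_ inc _] mn; rewrite ler_expR ler_wpM2r ?invr_ge0// lerN2.
suff h : nondecreasing_seq alpha by exact: h.
by apply/nondecreasing_seqP => i; exact: ltW.
Qed.

Lemma weight_cesaro_le alpha k (x : nat -> C) n : increasing_to_infty alpha ->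
  weight alpha k n * normc (arithmetic_mean x n) <=
  arithmetic_mean (fun i => weight alpha k i * normc (x i)) n.
Proof.
move=> ha; rewrite /arithmetic_mean /= normcM.
have -> : normc (n.+1%:R^-1 : C) = n.+1%:R^-1.
  rewrite normcV; congr (_^-1).
  by rewrite -(rmorph_nat (real_complex R)) /= expr0n addr0 sqrtr_sqr normr_nat.
rewrite mulrCA ler_wpM2l ?invr_ge0// !seriesEnat /=.
apply: (@le_trans _ _ (weight alpha k n * \sum_(0 <= i < n.+1) normc (x i))).
  rewrite ler_wpM2l ?weight_ge0//.
  elim: n.+1 => [|m IHm]; first by rewrite !big_nil normc0.
  rewrite !big_nat_recr//=; apply: le_trans (le_normcD _ _) _.
  by rewrite lerD2r.
rewrite mulr_sumr; apply: ler_sum_nat => i /andP[_ im].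
by rewrite ler_wpM2r ?normc_ge0// weight_homo.
Qed.

Lemma Lambda0_cesaro alpha (x : Lambda0 alpha) : increasing_to_infty alpha ->
  arithmetic_mean x \in Lambda0_pred alpha.
Proof.
move=> ha; apply/asboolP => k k0.
apply: (@squeeze_cvgr _ _ _ _ (fun=> 0)
  (arithmetic_mean (fun i => weight alpha k i * normc (x i)))).
- apply: nearW => n; rewrite mulr_ge0 ?weight_ge0 ?normc_ge0//=.
  exact: weight_cesaro_le.
- exact: cvg_cst.
- by apply: cesaro; exact: Lambda0P.
Qed.

Section Cesaro.
Variables (alpha : nat -> R) (halpha : increasing_to_infty alpha).

Definition cesaro_op (x : Lambda0 alpha) : Lambda0 alpha :=
  MkLambda0 (Lambda0_cesaro x halpha).

Lemma cesaro_op_linear : linear cesaro_op.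
Proof.
move=> a x y; apply/val_inj/funext => n.
change (arithmetic_mean (fun i => a * x i + y i) n =
  a * arithmetic_mean x n + arithmetic_mean y n).
rewrite /arithmetic_mean /= !seriesEnat /= mulrCA -mulrDr; congr (_ * _).
by rewrite mulr_sumr big_split.
Qed.

HB.instance Definition _ :=
  GRing.isLinear.Build C (Lambda0 alpha) (Lambda0 alpha) _ cesaro_op
    cesaro_op_linear.

Lemma cesaro_op_norm_le k (x : Lambda0 alpha) : (0 < k)%N ->
  Lambda0_norm k (cesaro_op x) <= Lambda0_norm k x.
Proof.
move=> k0; apply: Lambda0_norm_le => n.
apply: le_trans (weight_cesaro_le k x n halpha) _.
rewrite /arithmetic_mean /= ler_pdivrMl ?ltr0Sn// seriesEnat /=.
rewrite mulr_natl -[X in _ *+ X]subn0 -sumr_const_nat.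
by apply: ler_sum => i _; exact: Lambda0_norm_ub.
Qed.

Lemma cesaro_op_continuous : continuous cesaro_op.
Proof.
move=> x A /Lambda0_nbhsP[N [e [e0 h]]]; apply/Lambda0_nbhsP.
exists N, e; split=> // y hy; apply: h => k kN.
rewrite -linearB; apply: le_lt_trans (hy k kN).
by apply: cesaro_op_norm_le; case/andP: kN.
Qed.

End Cesaro.

End PowerSeriesSpace.

(* Main.v *)
From HB Require Import structures.
Require Import Defs.
From mathcomp Require Import all_boot all_order all_algebra ring_quotient.
From mathcomp Require Import complex.
From mathcomp Require Import all_classical all_reals all_analysis.
From mathcomp Require Import ring lra.

Set Implicit Arguments.
Unset Strict Implicit.
Unset Printing Implicit Defensive.

Import Order.TTheory GRing.Theory Num.Theory.
Import numFieldNormedType.Exports.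
Import Normc.

Local Open Scope classical_set_scope.
Local Open Scope complex_scope.
Local Open Scope ring_scope.

(** Write [w_k(n)] for the weights.  Exponentiating the logarithmic condition
    turns it into [weight_growth]: for each [k] there are [l > k] and [K] with
    [(n + 1) w_k(n) <= K w_l(n)] for all [n].  Both the invertibility of the
    Cesaro operator and nuclearity are shown to be equivalent to it.

    Cesaro operator.  It is injective, with inverse
    [x |-> (n + 1) x_n - n x_(n-1)].  Since the weights decrease in [n],
    [weight_growth] makes this a continuous operator on the power series space
    ([weight_growth_resolvent]).  Conversely a continuous inverse, tested on the
    unit vectors, yields [weight_growth] ([resolvent_weight_growth]).

    Nuclearity.  Continuous seminorms are exactly those dominated by a multiple
    of one of the norms ([continuous_seminormP]).  Two applications of
    [weight_growth] make [\sum_n w_k(n) / w_l(n)] finite for some [l]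
    ([weight_growth_summable]), and the expansion of a sequence in unit vectors
    is then a nuclear representation of the linking map between the local Banach
    spaces ([weight_growth_nuclear]).  Conversely, the trace of the linking map is
    bounded by its nuclear norm, so [\sum_n w_k(n) / w_l(n)] is finite
    ([nuclear_summable]); as the terms decrease, [n + 1] times the [n]-th one is
    bounded ([nuclear_weight_growth]).

    Nuclearity speaks of the completion of the space modulo the kernel of an
    arbitrary continuous seminorm.  Such a completion is constructed as the space
    of Cauchy sequences modulo null sequences ([localBanach_exists]), and maps are
    defined on it by extension from a dense subspace ([dense_extension]). *)

(** * Completeness of the complex numbers, and a convergent series *)

Lemma gt0_complexP (R : realType) (e : R[i]) : 0 < e ->
  exists2 d : R, 0 < d & e = d%:C.
Proof.
case: e => a b; rewrite ltcE /= => /andP[/eqP b0 a0].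
by exists a => //; rewrite b0.
Qed.

Lemma normcE (R : realType) (z : R[i]) : `|z| = (normc z)%:C.
Proof. by []. Qed.

Lemma normc_real (R : realType) (r : R) : 0 <= r -> normc (r%:C) = r.
Proof. by move=> r0; rewrite /= expr0n addr0 sqrtr_sqr ger0_norm. Qed.

Section ComplexComplete.
Variable R : realType.
Local Notation C := (R[i]).

Lemma complex_complete (F : set_system C^o) :
  ProperFilter F -> cauchy F -> cvg F.
Proof.
move=> FF /cauchyP Fc.
have ReB (a b : C) : `|complex.Re a - complex.Re b| <= normc (a - b).
  case: a b => [a1 a2] [b1 b2] /=; rewrite -sqrtr_sqr ler_wsqrtr// lerDl.
  exact: sqr_ge0.
have ImB (a b : C) : `|complex.Im a - complex.Im b| <= normc (a - b).
  case: a b => [a1 a2] [b1 b2] /=; rewrite -sqrtr_sqr ler_wsqrtr// lerDr.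
  exact: sqr_ge0.
have cv (g : C -> R) : (forall a b, `|g a - g b| <= normc (a - b)) -> cvg (g @ F).
  move=> hg; apply: cauchy_cvg; apply/cauchyP => e e0.
  have [|y hy] := Fc e%:C; first by rewrite ltcR.
  exists (g y); change (F [set z | ball (g y) e (g z)]).
  apply: filterS hy => z; rewrite -!ball_normE /= => hz.
  by apply: le_lt_trans (hg _ _) _; rewrite -ltcR.
have /cvg_ex[a ha] := cv _ ReB; have /cvg_ex[b hb] := cv _ ImB.
apply/cvg_ex; exists (a +i* b); apply/cvgrPdist_lt => e /gt0_complexP[d d0 ->].
have d2 : 0 < d / 2 by rewrite divr_gt0.
move/cvgrPdist_lt : ha => /(_ _ d2) ha; move/cvgrPdist_lt : hb => /(_ _ d2) hb.
apply: filterS2 ha hb => -[x y] /= h1 h2.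
rewrite ltcR; apply: (@le_lt_trans _ _ (`|a - x| + `|b - y|)); last lra.
rewrite -[leRHS]ger0_norm ?addr_ge0// -sqrtr_sqr ler_wsqrtr//.
rewrite -(real_normK (num_real (a - x))) -(real_normK (num_real (b - y))).
by rewrite sqrrD lerD2r lerDl mulrn_wge0 ?mulr_ge0.
Qed.

End ComplexComplete.

Lemma series_inv_sqr_cvg (R : realType) :
  cvgn (series (fun n => (n.+1%:R ^+ 2)^-1 : R)).
Proof.
apply: nondecreasing_is_cvgn.
  apply/nondecreasing_seqP => n; rewrite seriesSr lerDl invr_ge0.
  by rewrite exprn_ge0.
exists 2 => _ [n _ <-].
(* Telescoping: [1 / (n + 1) ^ 2 <= 1 / n - 1 / (n + 1)]. *)
suff h N : series (fun n => (n.+1%:R ^+ 2)^-1 : R) N.+1 <= 2 - N.+1%:R^-1.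
  case: n => [|n]; first by rewrite seriesEnat /= big_nil.
  by apply: le_trans (h n) _; rewrite lerBlDr lerDl invr_ge0.
elim: N => [|N IHN].
  by rewrite seriesEnat /= big_nat1 expr1n invr1; lra.
rewrite seriesSr; apply: le_trans (lerD IHN (lexx _)) _.
have a0 : 0 < N.+1%:R :> R by rewrite ltr0Sn.
rewrite -[N.+2%:R]natr1; set a := N.+1%:R in a0 *.
have a1 : 0 < a + 1 by lra.
have -> : 2 - a^-1 + ((a + 1) ^+ 2)^-1 =
  2 - (a + 1)^-1 - (a * (a + 1) ^+ 2)^-1 by field; lra.
by rewrite lerBlDr lerDl invr_ge0 mulr_ge0 ?exprn_ge0// ltW.
Qed.

(** * Extension of dominated linear maps *)

Lemma contraction_continuous (K : numFieldType) (V W : normedModType K)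
  (f : {linear V -> W}) : (forall x, `|f x| <= `|x|) -> continuous f.
Proof.
move=> hf x; apply/cvgrPdist_lt => e e0.
near=> y; rewrite -linearB; apply: le_lt_trans (hf _) _.
by near: y; apply: cvgr_dist_lt.
Unshelve. all: by end_near. Qed.

Section DenseExtension.
Variables (K : numFieldType) (X : lmodType K) (Y : normedModType K).
Variables (Z : normedModType K) (m : {linear X -> Y}).
Variables (f : {linear X -> Z}).
Hypothesis Z_complete : forall F : set_system Z,
  ProperFilter F -> cauchy F -> cvg F.
Hypothesis m_dense : dense (range m).
Hypothesis f_le : forall x, `|f x| <= `|m x|.

Lemma dense_approx y e : 0 < e -> exists x, `|m x - y| < e.
Proof.
move=> e0; have /m_dense : ball y e !=set0 by exists y; exact: ballxx.
move=> /(_ (ball_open _ _))[z [yz [x _ mx]]]; exists x.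
by rewrite mx distrC; move: yz; rewrite -ball_normE.
Qed.

(** The closure of the graph [{(m x, f x)}]: the domination of [f] by [m] makes
     it the graph of a function, density and completeness make that function
    total. *)
Let graph y l := forall e : K, 0 < e -> exists x, `|m x - y| < e /\ `|f x - l| < e.

Let graph_ex y : exists l, graph y l.
Proof.
pose F : set_system Z :=
  filter_from [set e : K | 0 < e] (fun e => [set f x | x in [set x | `|m x - y| < e]]).
have FF : ProperFilter F.
  apply: filter_from_proper.
    apply: filter_from_filter; first by exists 1 => /=.
    move=> e d /= e0 d0; exists (Num.min e d).
      by rewrite /= /Num.min; case: ifP.
    have cmp : (e >=< d)%O by apply: real_comparable; exact: gtr0_real.
    move=> _ [x /= hx <-].
    by move: hx; rewrite comparable_lt_min// => /andP[h1 h2]; split; exists x.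
  by move=> e e0; have [x hx] := dense_approx y e0; exists (f x), x.
have : cvg F.
  apply: Z_complete; apply/cauchy_ballP => e e0.
  have e20 : 0 < e / 2 by rewrite divr_gt0.
  pose A := [set f x | x in [set x | `|m x - y| < e / 2]].
  exists (A, A); first by split; exists (e / 2).
  move=> [_ _] /= [[x1 /= h1 <-] [x2 /= h2 <-]].
  rewrite -ball_normE /= -linearB; apply: le_lt_trans (f_le _) _.
  rewrite linearB /= -(subrKA y) (splitr e); apply: le_lt_trans (ler_normD _ _) _.
  by rewrite ltrD// distrC.
move=> /cvg_ex[l Fl]; exists l => e e0.
have /Fl [d d0 hd] : nbhs l (ball l e) by exact: nbhsx_ballx.
pose c := Num.min e d.
have cmp : (e >=< d)%O by apply: real_comparable; exact: gtr0_real.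
have c0 : 0 < c by rewrite /c /Num.min; case: ifP.
have [x] := dense_approx y c0; rewrite comparable_lt_min// => /andP[xe xd].
exists x; split => //.
have /hd : [set f x | x in [set x | `|m x - y| < d]] (f x) by exists x.
by rewrite -ball_normE /= distrC.
Qed.

Let graph_norm y l : graph y l -> `|l| <= `|y|.
Proof.
move=> g; apply/ler_addgt0Pr => e e0.
have [x [h1 h2]] := g (e / 2) (divr_gt0 e0 (ltr0Sn _ 1)).
rewrite -(subKr (f x) l); apply: le_trans (ler_normB _ _) _.
rewrite (splitr e) addrA lerD//; last exact: ltW.
apply: le_trans (f_le x) _; rewrite -[m x](subrKC y).
by apply: le_trans (ler_normD _ _) _; rewrite lerD2l ltW.
Qed.

Let graph_lin a y l y' l' : graph y l -> graph y' l' ->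
  graph (a *: y + y') (a *: l + l').
Proof.
move=> g g' e e0.
have D0 : 0 < `|a| + 1 by rewrite ltr_wpDl.
have d0 : 0 < e / (`|a| + 1) / 2 by rewrite !divr_gt0.
have [x [h1 h2]] := g _ d0; have [x' [h1' h2']] := g' _ d0.
have lin_close (V : normedModType K) (u v u' v' : V) :
  `|u - v| < e / (`|a| + 1) / 2 -> `|u' - v'| < e / (`|a| + 1) / 2 ->
  `|a *: u + u' - (a *: v + v')| < e.
  move=> k1 k2; rewrite opprD addrACA -scalerBr.
  apply: le_lt_trans (ler_normD _ _) _; rewrite normrZ.
  apply: (@le_lt_trans _ _ ((`|a| + 1) * (e / (`|a| + 1) / 2))).
    by rewrite mulrDl mul1r lerD ?ler_wpM2l// ltW.
  rewrite mulrA mulrCA divff ?lt0r_neq0// mulr1 ltr_pdivrMr// ltr_pMr//.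
  by rewrite ltr1n.
by exists (a *: x + x'); rewrite (linearP m) (linearP f); split; exact: lin_close.
Qed.

Let graph_m x : graph (m x) (f x).
Proof. by move=> e e0; exists x; rewrite !subrr !normr0. Qed.

Let graph_uniq y l l' : graph y l -> graph y l' -> l = l'.
Proof.
move=> g g'; apply/eqP; rewrite -subr_eq0 -normr_le0.
have /graph_norm := graph_lin (-1) g' g.
by rewrite !scaleN1r addNr normr0 addrC.
Qed.

(** The extension principle behind every map out of a local Banach space used
    below: the linking map between two of them, and the extended coordinate
    functionals. *)
Lemma dense_extension : exists g : {linear Y -> Z},
  (forall x, g (m x) = f x) /\ (forall y, `|g y| <= `|y|).
Proof.
pose g y := sval (cid (graph_ex y)).
have gP y : graph y (g y) by rewrite /g; case: cid.
have lin : linear g.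
  move=> a y y'; apply: graph_uniq (gP _) _; exact: graph_lin.
pose G := GRing.isLinear.Build K Y Z _ g lin.
pose gl : {linear Y -> Z} := HB.pack g G.
exists gl; split; last by move=> y; exact: graph_norm (gP y).
by move=> x; apply: graph_uniq (gP _) (graph_m x).
Qed.

End DenseExtension.

(** * Completion of a seminormed space *)

Section Seminorm.
Variables (R : realType) (X : lmodType R[i]) (p : X -> R).
Hypothesis hp : seminorm p.

Lemma seminormD x y : p (x + y) <= p x + p y.
Proof. by case: hp. Qed.

Lemma seminormZ a x : p (a *: x) = normc a * p x.
Proof. by case: hp. Qed.

Lemma seminorm0 : p 0 = 0.
Proof. by rewrite -(scale0r (0 : X)) seminormZ normc0 mul0r. Qed.

Lemma seminormN x : p (- x) = p x.
Proof. by rewrite -scaleN1r seminormZ normcN normc1 mul1r. Qed.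

Lemma seminorm_ge0 x : 0 <= p x.
Proof.
have := seminormD x (- x); rewrite subrr seminorm0 seminormN.
by rewrite -mulr2n pmulrn_lge0.
Qed.

Lemma seminormBC x y : p (x - y) = p (y - x).
Proof. by rewrite -opprB seminormN. Qed.

Lemma seminorm_dist x y : `|p x - p y| <= p (x - y).
Proof.
have h u v : p u - p v <= p (u - v).
  by rewrite lerBlDr -[X in p X <= _](subrK v); exact: seminormD.
by rewrite ler_norml lerNl opprB h seminormBC h.
Qed.

End Seminorm.

Section SeparatedQuotient.
Variables (R : realType) (V : lmodType R[i]) (p : V -> R) (hp : seminorm p).
Local Notation C := R[i].

(** The proof that [p] is a seminorm is an argument so that the closure
    properties of the kernel can be inferred from the predicate itself. *)
Definition seminorm_kernel of seminorm p : {pred V} := [pred x | p x == 0].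

Fact seminorm_kernel_submod : submod_closed (seminorm_kernel hp).
Proof.
split=> [|a x y]; rewrite !inE ?(seminorm0 hp)// => /eqP px /eqP py.
rewrite eq_le (seminorm_ge0 hp) andbT; apply: le_trans (seminormD hp _ _) _.
by rewrite (seminormZ hp) px py mulr0 addr0.
Qed.

HB.instance Definition _ :=
  GRing.isSubmodClosed.Build _ _ (seminorm_kernel hp) seminorm_kernel_submod.

Definition sepquot := Quotient.quot (seminorm_kernel hp).
HB.instance Definition _ := GRing.Zmodule.on sepquot.

Definition sepquot_pi (x : V) : sepquot :=
  \pi_(Quotient.quot (seminorm_kernel hp))%qT x.
Definition sepquot_repr (x : sepquot) : V :=
  repr (x : Quotient.quot (seminorm_kernel hp)).

Lemma sepquot_reprK : cancel sepquot_repr sepquot_pi.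
Proof. by move=> x; rewrite /sepquot_pi reprK. Qed.

Lemma sepquot_piP x y : sepquot_pi x = sepquot_pi y <-> p (x - y) = 0.
Proof.
split=> [/eqP|h]; first by rewrite -Quotient.idealrBE inE => /eqP.
by apply/eqP; rewrite -Quotient.idealrBE inE; apply/eqP.
Qed.

Lemma sepquot_piD x y : sepquot_pi (x + y) = sepquot_pi x + sepquot_pi y.
Proof. by rewrite /sepquot_pi !piE. Qed.

Definition sepquot_scale (a : C) (x : sepquot) : sepquot :=
  sepquot_pi (a *: sepquot_repr x).

Lemma sepquot_piZ a x : sepquot_pi (a *: x) = sepquot_scale a (sepquot_pi x).
Proof.
apply/sepquot_piP; rewrite -scalerBr (seminormZ hp).
by have /sepquot_piP -> := esym (sepquot_reprK (sepquot_pi x)); rewrite mulr0.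
Qed.

Fact sepquot_scaleA a b v :
  sepquot_scale a (sepquot_scale b v) = sepquot_scale (a * b) v.
Proof. by rewrite -[v]sepquot_reprK -!sepquot_piZ scalerA. Qed.

Fact sepquot_scale1 : left_id 1 sepquot_scale.
Proof. by move=> v; rewrite -[v]sepquot_reprK -sepquot_piZ scale1r. Qed.

Fact sepquot_scaleDr : right_distributive sepquot_scale +%R.
Proof.
move=> a v w; rewrite -[v]sepquot_reprK -[w]sepquot_reprK.
by rewrite -sepquot_piD -!sepquot_piZ scalerDr sepquot_piD.
Qed.

Fact sepquot_scaleDl v : {morph sepquot_scale^~ v : a b / a + b}.
Proof.
move=> a b; rewrite -[v]sepquot_reprK.
by rewrite -!sepquot_piZ scalerDl sepquot_piD.
Qed.

HB.instance Definition _ := GRing.Zmodule_isLmodule.Build C sepquot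
  sepquot_scaleA sepquot_scale1 sepquot_scaleDr sepquot_scaleDl.

Fact sepquot_pi_linear : linear sepquot_pi.
Proof. by move=> a x y; rewrite sepquot_piD sepquot_piZ. Qed.

HB.instance Definition _ :=
  GRing.isLinear.Build C V sepquot _ sepquot_pi sepquot_pi_linear.

Definition sepquot_norm (x : sepquot) : C := (p (sepquot_repr x))%:C.

Lemma sepquot_norm_pi x : sepquot_norm (sepquot_pi x) = (p x)%:C.
Proof.
congr (_%:C); apply/eqP; rewrite -subr_eq0 -normr_le0.
apply: le_trans (seminorm_dist hp _ _) _.
by have /sepquot_piP -> := sepquot_reprK (sepquot_pi x).
Qed.

Fact sepquot_normD x y : sepquot_norm (x + y) <= sepquot_norm x + sepquot_norm y.
Proof.
rewrite -[x]sepquot_reprK -[y]sepquot_reprK -linearD !sepquot_norm_pi.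
by rewrite -rmorphD lecR; exact: (seminormD hp).
Qed.

Fact sepquot_normZ a x : sepquot_norm (a *: x) = `|a| * sepquot_norm x.
Proof.
rewrite -[x]sepquot_reprK -linearZ !sepquot_norm_pi.
by rewrite (seminormZ hp) rmorphM.
Qed.

Fact sepquot_norm0_eq0 x : sepquot_norm x = 0 -> x = 0.
Proof.
rewrite -[x]sepquot_reprK !sepquot_norm_pi => -[h].
by rewrite -(linear0 sepquot_pi); apply/sepquot_piP; rewrite subr0.
Qed.

HB.instance Definition _ := Lmodule_isNormed.Build C sepquot
  sepquot_normD sepquot_normZ sepquot_norm0_eq0.

Lemma norm_sepquot_pi x : `|sepquot_pi x| = (p x)%:C.
Proof. exact: sepquot_norm_pi. Qed.

End SeparatedQuotient.

Section CauchySequences.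
Variables (R : realType) (X : lmodType R[i]) (p : X -> R) (hp : seminorm p).
Local Notation C := R[i].

(** As for [seminorm_kernel], the proof of [seminorm p] is carried along for the
    inference of the module structure. *)
Definition cauchy_seq_pred of seminorm p : {pred nat -> X} :=
  [pred x : nat -> X | `[< forall e : R, 0 < e ->
     exists N, forall m n, (N <= m)%N -> (N <= n)%N -> p (x m - x n) < e >]].

Fact cauchy_seq_submod : submod_closed (cauchy_seq_pred hp).
Proof.
split=> [|a x y].
  apply/asboolP => e e0; exists 0%N => m n _ _.
  by rewrite subrr (seminorm0 hp).
move=> /asboolP hx /asboolP hy; apply/asboolP => e e0.
have D0 : 0 < normc a + 1 by rewrite ltr_wpDl// normc_ge0.
have d0 : 0 < e / (normc a + 1) / 2 by rewrite !divr_gt0.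
have [N hN] := hx _ d0; have [M hM] := hy _ d0.
exists (maxn N M) => m n; rewrite !geq_max => /andP[Nm Mm] /andP[Nn Mn].
have -> : (a *: x + y) m - (a *: x + y) n = a *: (x m - x n) + (y m - y n).
  by rewrite scalerBr opprD addrACA.
apply: le_lt_trans (seminormD hp _ _) _; rewrite (seminormZ hp).
have hx' := hN m n Nm Nn; have hy' := hM m n Mm Mn.
apply: (@le_lt_trans _ _ ((normc a + 1) * (e / (normc a + 1) / 2))).
  by rewrite mulrDl mul1r lerD ?ler_wpM2l ?normc_ge0// ltW.
rewrite mulrA mulrCA divff ?lt0r_neq0// mulr1; lra.
Qed.

HB.instance Definition _ :=
  GRing.isSubmodClosed.Build _ _ (cauchy_seq_pred hp) cauchy_seq_submod.

Record cauchy_seq := MkCauchySeq {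
  cauchy_seq_val :> nat -> X;
  _ : cauchy_seq_val \in cauchy_seq_pred hp }.

HB.instance Definition _ := [isSub for cauchy_seq_val].
HB.instance Definition _ := [Choice of cauchy_seq by <:].
HB.instance Definition _ := [SubChoice_isSubLmodule of cauchy_seq by <:].

Lemma cauchy_seqP (x : cauchy_seq) (e : R) : 0 < e ->
  exists N, forall m n, (N <= m)%N -> (N <= n)%N -> p (x m - x n) < e.
Proof. by case: x => x /= /asboolP; apply. Qed.

Definition cauchy_seq_seminorm (x : cauchy_seq) : R := limn (p \o x).

Lemma cauchy_seq_cvg (x : cauchy_seq) : p \o x @ \oo --> cauchy_seq_seminorm x.
Proof.
apply: cauchy_cvg; apply: cauchy_exP => e e0.
have [N hN] := cauchy_seqP x e0; exists (p (x N)), N => // n /= Nn.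
rewrite -ball_normE /=; apply: le_lt_trans (seminorm_dist hp _ _) _.
exact: hN.
Qed.

Lemma cauchy_seq_seminormP : seminorm cauchy_seq_seminorm.
Proof.
split=> [x y|a x]; last first.
  apply: cvg_lim => //=.
  rewrite (_ : p \o _ = fun n => normc a * p (x n)).
    by apply: cvgMr; exact: cauchy_seq_cvg.
  by apply/funext => n; rewrite /= -(seminormZ hp).
have := ler_cvg_to (@cauchy_seq_cvg (x + y))
  (cvgD (@cauchy_seq_cvg x) (@cauchy_seq_cvg y)); apply.
by apply: nearW => n; exact: (seminormD hp).
Qed.

Fact cauchy_seq_cst_subproof (x : X) : (fun=> x) \in cauchy_seq_pred hp.
Proof.
by apply/asboolP => e e0; exists 0%N => m n _ _; rewrite subrr (seminorm0 hp).
Qed.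

Definition cauchy_seq_cst (x : X) := MkCauchySeq (cauchy_seq_cst_subproof x).

Fact cauchy_seq_cst_linear : linear cauchy_seq_cst.
Proof. by move=> a x y; apply/val_inj/funext. Qed.

HB.instance Definition _ :=
  GRing.isLinear.Build C X cauchy_seq _ cauchy_seq_cst cauchy_seq_cst_linear.

Lemma cauchy_seq_seminorm_cst x : cauchy_seq_seminorm (cauchy_seq_cst x) = p x.
Proof. by apply: cvg_lim => //=; exact: cvg_cst. Qed.

Lemma cauchy_seq_approx (x : cauchy_seq) (e : R) n :
  (forall i, (n <= i)%N -> p (x i - x n) <= e) ->
  cauchy_seq_seminorm (x - cauchy_seq_cst (x n)) <= e.
Proof.
move=> h; apply: (ler_cvg_to (@cauchy_seq_cvg _) (cvg_cst e)).
by exists n => // i /= ni; exact: h.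
Qed.

(** The Cauchy sequences carry the seminorm [lim p (x n)], whose kernel consists
    of the null sequences; so the completion is a separated quotient. *)
Definition completion := sepquot cauchy_seq_seminormP.
HB.instance Definition _ := NormedModule.on completion.

Definition completion_map : X -> completion :=
  sepquot_pi cauchy_seq_seminormP \o cauchy_seq_cst.
HB.instance Definition _ := GRing.Linear.on completion_map.

Lemma norm_completion_map x : `|completion_map x| = (p x)%:C.
Proof. by rewrite norm_sepquot_pi cauchy_seq_seminorm_cst. Qed.

Lemma completion_approx (y : completion) (e : R) : 0 < e ->
  exists x, `|completion_map x - y| < e%:C.
Proof.
move=> e0; rewrite -[y]sepquot_reprK; set z := sepquot_repr y.
have [N hN] := cauchy_seqP z (divr_gt0 e0 (ltr0Sn _ 1)).
exists (z N); rewrite distrC -linearB norm_sepquot_pi ltcR.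
apply: (@le_lt_trans _ _ (e / 2)); last by rewrite ltr_pdivrMr// ltr_pMr// ltr1n.
by apply: cauchy_seq_approx => i Ni; rewrite ltW// hN.
Qed.

Lemma completion_dense : dense (range completion_map).
Proof.
move=> O [y Oy] oO; have [e /= e0 he] : nbhs_ball y O.
  by rewrite nbhs_ballE; exact: open_nbhs_nbhs.
have [d d0 ed] := gt0_complexP e0.
have [x hx] := completion_approx y d0.
exists (completion_map x); split; last by exists x.
by apply: he; rewrite -ball_normE /= distrC ed.
Qed.

(** A Cauchy filter is followed by points of [X]: for each [n], some
    ball of radius [1 / (n + 1)] centred at the image of a point [x n] belongs to
    the filter.  These points form a Cauchy sequence of [X], and its class is the
    limit. *)
Lemma completion_complete (F : set_system completion) :
  ProperFilter F -> cauchy F -> cvg F.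
Proof.
move=> FF /cauchyP Fc.
pose r n : R := n.+1%:R^-1.
have r0 n : 0 < r n by rewrite invr_gt0.
have rle n i : (n <= i)%N -> r i <= r n by move=> ni; rewrite lef_pV2 ?posrE// ler_nat.
have rlt e : 0 < e -> exists n, r n < e.
  move=> e0; have [N _ /(_ N (leqnn N))] := near_infty_natSinv_lt (PosNum e0).
  by exists N.
have [x hx] : {x : nat -> X & forall n, F (ball (completion_map (x n)) (r n)%:C)}.
  apply: (@choice _ _ (fun n x => F (ball (completion_map x) (r n)%:C))) => n.
  have r2 : 0 < r n / 2 by rewrite divr_gt0.
  have [y hy] : exists y, F (ball y (r n / 2)%:C) by apply: Fc; rewrite ltcR.
  have [x hx] := completion_approx y r2; exists x.
  apply: filterS hy => z; rewrite -!ball_normE /= => hz.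
  rewrite (splitr (r n)) rmorphD.
  by apply: le_lt_trans (ler_distD y _ _) _; rewrite ltrD.
have hp2 n i : p (x n - x i) < r n + r i.
  have [y [+ +]] := filter_ex (filterI (hx n) (hx i)).
  rewrite -!ball_normE /= => h1 h2.
  rewrite -ltcR -norm_completion_map linearB /= rmorphD.
  by apply: le_lt_trans (ler_distD y _ _) _; rewrite ltrD// distrC.
have xc : x \in cauchy_seq_pred hp.
  apply/asboolP => e e0; have [N hN] := rlt _ (divr_gt0 e0 (ltr0Sn _ 1)).
  exists N => m n Nm Nn; apply: lt_trans (hp2 m n) _.
  have := rle _ _ Nm; have := rle _ _ Nn; lra.
pose z : completion := sepquot_pi cauchy_seq_seminormP (MkCauchySeq xc).
have hz n : `|z - completion_map (x n)| <= (r n + r n)%:C.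
  rewrite -linearB norm_sepquot_pi lecR.
  apply: cauchy_seq_approx => i ni; apply: ltW; apply: lt_le_trans (hp2 i n) _.
  by rewrite lerD2r rle.
apply/cvg_ex; exists z; apply/cvgrPdist_lt => e e0.
have [d d0 ->] := gt0_complexP e0.
have [n hn] := rlt _ (divr_gt0 d0 (ltr0Sn _ 3)).
apply: filterS (hx n) => y; rewrite -ball_normE /= => hy.
apply: le_lt_trans (ler_distD (completion_map (x n)) _ _) _.
apply: le_lt_trans (lerD (hz n) (ltW hy)) _.
by rewrite -rmorphD ltcR; lra.
Qed.

HB.instance Definition _ :=
  Uniform_isComplete.Build completion completion_complete.

Lemma localBanach_exists : inhabited (localBanach p).
Proof.
by constructor; exact: (@LocalBanach _ _ _ completion completion_map
  norm_completion_map completion_dense).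
Qed.

End CauchySequences.

Lemma localBanach_extension (R : realType) (X : lmodType R[i]) (p : X -> R)
    (Y : localBanach p) (Z : normedModType R[i]) (f : {linear X -> Z}) :
  (forall F : set_system Z, ProperFilter F -> cauchy F -> cvg F) ->
  (forall x, `|f x| <= (p x)%:C) ->
  exists g : {linear Y -> Z}, (forall x, g (localBanach_map Y x) = f x) /\
    (forall y, `|g y| <= `|y|).
Proof.
move=> cZ h; apply: dense_extension; [exact: cZ|exact: localBanach_dense|].
by move=> x; rewrite localBanach_norm.
Qed.

(** * Norms, unit vectors and continuous seminorms of power series spaces *)

Section PowerSeries.
Variables (R : realType) (alpha : nat -> R).
Local Notation C := (R[i]).
Local Notation L := (Lambda0 alpha).
Implicit Types x y : L.

Lemma weight_gt0 k n : 0 < weight alpha k n.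
Proof. exact: expR_gt0. Qed.

Lemma weight_le k l n : increasing_to_infty alpha -> (0 < k)%N -> (k <= l)%N ->
  weight alpha k n <= weight alpha l n.
Proof.
move=> [a1 _ _] k0 kl; rewrite ler_expR !mulNr lerN2 ler_wpM2l//.
  exact: ltW (lt_trans ltr01 (a1 n)).
by rewrite lef_pV2 ?posrE ?ltr0n ?ler_nat// (leq_trans k0).
Qed.

Lemma Lambda0_norm_homo k l x : increasing_to_infty alpha ->
  (0 < k)%N -> (k <= l)%N -> Lambda0_norm k x <= Lambda0_norm l x.
Proof.
move=> ha k0 kl; apply: Lambda0_norm_le => n.
apply: le_trans (Lambda0_norm_ub x n (leq_trans k0 kl)).
by rewrite ler_wpM2r ?normc_ge0 ?weight_le.
Qed.

Lemma Lambda0_norm_seminorm k : (0 < k)%N -> seminorm (@Lambda0_norm R alpha k).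
Proof.
move=> k0; split=> [x y|a x]; first exact: Lambda0_normD.
apply/eqP; rewrite eq_le Lambda0_norm_leZ//=.
have [->|a0] := eqVneq a 0; first by rewrite scale0r normc0 mul0r Lambda0_norm0.
have na0 : 0 < normc a.
  by rewrite lt_def normc_ge0 andbT; apply: contra_neq a0 => /eq0_normc.
rewrite -ler_pdivlMl// -normcV.
by have := Lambda0_norm_leZ a^-1 (a *: x) k0; rewrite scalerA mulVf// scale1r.
Qed.

Definition scaled_coordinate (a : C) n x : C^o := a * x n.

Fact scaled_coordinate_linear a n : linear (scaled_coordinate a n).
Proof.
by move=> b x y; rewrite /scaled_coordinate mulrDr mulrCA.
Qed.

HB.instance Definition _ a n := GRing.isLinear.Build C L C^o _
  (scaled_coordinate a n) (scaled_coordinate_linear a n).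

Fact unit_vector_subproof n : (fun i => (i == n)%:R : C) \in Lambda0_pred alpha.
Proof.
apply/asboolP => k k0; apply: cvg_near_cst; exists n.+1 => // i /= ni.
by rewrite gtn_eqF// normc0 mulr0.
Qed.

Definition unit_vector n : L := MkLambda0 (unit_vector_subproof n).

Lemma unit_vectorE n i : unit_vector n i = (i == n)%:R.
Proof. by []. Qed.

Lemma Lambda0_sumE (c : nat -> C) N j :
  (\sum_(i < N) c i *: unit_vector i) j = if (j < N)%N then c j else 0.
Proof.
rewrite -[LHS]mul1r -[LHS]/(scaled_coordinate 1 j _) linear_sum.
transitivity (\sum_(i < N) c i * (j == i)%:R).
  by apply: eq_bigr => i _; rewrite linearZ /= /scaled_coordinate mul1r.
case: ltnP => jN.
  rewrite (bigD1 (Ordinal jN))//= eqxx big1 ?addr0; first by rewrite mulr1.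
  by move=> i; rewrite -val_eqE /= eq_sym => /negPf ->; rewrite mulr0.
by rewrite big1// => i _; rewrite gtn_eqF ?(leq_trans (ltn_ord i))// mulr0.
Qed.

Lemma Lambda0_norm_sum_le k (c : nat -> C) N M : 0 <= M ->
  (forall i, (i < N)%N -> weight alpha k i * normc (c i) <= M) ->
  Lambda0_norm k (\sum_(i < N) c i *: unit_vector i) <= M.
Proof.
move=> M0 h; apply: Lambda0_norm_le => n; rewrite Lambda0_sumE.
by case: ltnP => [/h//|_]; rewrite normc0 mulr0.
Qed.

Lemma Lambda0_norm_unit_vector k n : (0 < k)%N ->
  Lambda0_norm k (unit_vector n) = weight alpha k n.
Proof.
move=> k0; apply/eqP; rewrite eq_le; apply/andP; split.
  apply: Lambda0_norm_le => i; rewrite unit_vectorE.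
  by case: eqP => [->|_]; rewrite ?normc1 ?mulr1// normc0 mulr0 weight_ge0.
have := Lambda0_norm_ub (unit_vector n) n k0.
by rewrite unit_vectorE eqxx normc1 mulr1.
Qed.

Lemma unit_vector_expansion_cvg k x : (0 < k)%N ->
  Lambda0_norm k (x - \sum_(i < N) x i *: unit_vector i) @[N --> \oo] --> 0.
Proof.
move=> k0; apply/cvgrPdist_le => e e0.
have /cvgrPdist_le/(_ e e0)[N _ hN] := Lambda0P x k0.
exists N => // n /= Nn; rewrite sub0r normrN ger0_norm ?Lambda0_norm_ge0//.
apply: Lambda0_norm_le => i.
have -> : (x - \sum_(i < n) x i *: unit_vector i) i = if (i < n)%N then 0 else x i.
  rewrite -[LHS]/(x i - (\sum_(j < n) x j *: unit_vector j) i) Lambda0_sumE.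
  by case: ifP => _; rewrite ?subrr ?subr0.
case: ltnP => ni; first by rewrite normc0 mulr0 ltW.
have := hN i (leq_trans Nn ni).
by rewrite sub0r normrN ger0_norm// mulr_ge0 ?weight_ge0 ?normc_ge0.
Qed.

(** The norms increase with [k], so a neighbourhood of [0] contains a ball of a
    single norm, and homogeneity turns that inclusion into a bound. *)
Lemma continuous_seminormP (q : L -> R) : increasing_to_infty alpha ->
  seminorm q ->
  continuous q <->
  exists k K, [/\ (0 < k)%N, 0 < K & forall x, q x <= K * Lambda0_norm k x].
Proof.
move=> ha hq; split=> [cq|[k [K [k0 K0 hK]]] x].
  have : nbhs (0 : L) [set x | q x < 1].
    have /cvgrPdist_lt/(_ 1 ltr01) := cq 0.
    apply: filterS => x /=.
    by rewrite (seminorm0 hq) sub0r normrN ger0_norm// (seminorm_ge0 hq).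
  move=> /Lambda0_nbhsP[N [e [e0 h]]].
  exists N.+1, e^-1; split; rewrite ?invr_gt0// => x.
  (* [x] is scaled into the ball of radius [e]; the slack [d] keeps the scaling
   factor finite when the norm of [x] vanishes. *)
rewrite ler_pdivlMl//; apply/ler_addgt0Pr => d d0.
  have D0 : 0 < Lambda0_norm N.+1 x + d by rewrite ltr_wpDl// Lambda0_norm_ge0.
  pose s := (e / (Lambda0_norm N.+1 x + d))%:C.
  have ns : normc s = e / (Lambda0_norm N.+1 x + d).
    by rewrite /= expr0n addr0 sqrtr_sqr ger0_norm// divr_ge0// ltW.
  have /h /= : Lambda0_ball (0 : L) N e (s *: x).
    move=> k /andP[k0 kN]; rewrite subr0.
    apply: le_lt_trans (Lambda0_norm_homo _ ha k0 (leqW kN)) _.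
    rewrite (seminormZ (Lambda0_norm_seminorm _))// ns -mulrA gtr_pMr//.
    by rewrite ltr_pdivrMl// mulr1 ltrDl.
  by rewrite (seminormZ hq) ns mulrAC ltr_pdivrMr// mul1r => /ltW.
move=> A /nbhs_ballP[e /= e0 heA]; apply/Lambda0_nbhsP; exists k, (e / K).
split; first by rewrite divr_gt0.
move=> y hy; apply: heA; rewrite -ball_normE /=.
rewrite distrC; apply: le_lt_trans (seminorm_dist hq _ _) _.
apply: le_lt_trans (hK _) _; rewrite -ltr_pdivlMl// mulrC.
by apply: hy; rewrite k0 leqnn.
Qed.

End PowerSeries.

(** * Growth conditions on the weights *)

Section Growth.
Variables (R : realType) (alpha : nat -> R).

Definition log_growth : Prop := forall k : nat, (0 < k)%N ->
  exists l : nat, (k < l)%N /\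
    (ereal_sup (range (fun n : nat =>
      (ln n.+1%:R - (k%:R^-1 - l%:R^-1) * alpha n)%:E)) < +oo)%E.

(** [log_growth] without logarithms: multiplication by [n + 1] is bounded from
    the [l]-th weighted sup norm to the [k]-th one. *)
Definition weight_growth : Prop := forall k, (0 < k)%N ->
  exists l K, [/\ (k < l)%N, 0 < K &
    forall n, n.+1%:R * weight alpha k n <= K * weight alpha l n].

Lemma weight_growth_ln k l n M :
  (n.+1%:R * weight alpha k n <= expR M * weight alpha l n) =
  (ln n.+1%:R - (k%:R^-1 - l%:R^-1) * alpha n <= M).
Proof.
rewrite -{1}[n.+1%:R]lnK ?posrE ?ltr0Sn// -!expRD ler_expR.
by rewrite -[LHS]subr_ge0 -[RHS]subr_ge0; congr (0 <= _); ring.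
Qed.

Lemma log_growthP : log_growth <-> weight_growth.
Proof.
split=> h k /h.
  case=> l [kl hl]; set S := ereal_sup _ in hl.
  have ub n : ((ln n.+1%:R - (k%:R^-1 - l%:R^-1) * alpha n)%:E <= S)%E.
    by apply: ereal_sup_ubound; exists n.
  exists l, (expR (fine S)); split => // [|n]; first exact: expR_gt0.
  rewrite weight_growth_ln -lee_fin fineK//.
  by rewrite fin_numE -ltey hl andbT -ltNye (lt_le_trans _ (ub 0%N))// ltNye.
case=> l [K [kl K0 hK]]; exists l; split => //.
apply: (@le_lt_trans _ _ (ln K)%:E); last by rewrite ltey.
apply: ge_ereal_sup => _ [n _ <-].
by rewrite lee_fin -weight_growth_ln lnK ?posrE.
Qed.

End Growth.

(** * The inverse of the Cesaro operator *)

Section Operators.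
Variables (R : realType) (alpha : nat -> R).
Hypothesis ha : increasing_to_infty alpha.
Local Notation C := (R[i]).
Local Notation L := (Lambda0 alpha).

Lemma Lambda0_norm_continuous k : (0 < k)%N ->
  continuous (@Lambda0_norm R alpha k).
Proof.
move=> k0; apply/(continuous_seminormP ha (Lambda0_norm_seminorm _ k0)).
by exists k, 1; split => // x; rewrite mul1r.
Qed.

Lemma continuous_linearP (T : {linear L -> L}) :
  continuous T <->
  forall k, (0 < k)%N -> exists l K, [/\ (0 < l)%N, 0 < K &
    forall x, Lambda0_norm k (T x) <= K * Lambda0_norm l x].
Proof.
split=> [cT k k0|h x A /Lambda0_nbhsP[N [e [e0 hA]]]].
  have hq := Lambda0_norm_seminorm alpha k0.
  have hqT : seminorm (@Lambda0_norm R alpha k \o T).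
    split=> [x y|a x] /=; first by rewrite linearD; exact: Lambda0_normD.
    by rewrite linearZ (seminormZ hq).
  apply/(continuous_seminormP ha hqT) => x.
  by apply: continuous_comp; [exact: cT|exact: Lambda0_norm_continuous].
have [l [K [l0 K0 hK]]] := h N.+1 isT.
apply/Lambda0_nbhsP; exists l, (e / K); split; first by rewrite divr_gt0.
move=> y hy; apply: hA => k /andP[k0 kN].
rewrite -linearB; apply: le_lt_trans (Lambda0_norm_homo _ ha k0 (leqW kN)) _.
apply: le_lt_trans (hK _) _; rewrite -ltr_pdivlMl// mulrC.
by apply: hy; rewrite l0 leqnn.
Qed.

Lemma arithmetic_meanE (x : nat -> C) n :
  n.+1%:R * arithmetic_mean x n = series x n.+1.
Proof. by rewrite /arithmetic_mean /= mulrA divff ?mul1r// pnatr_eq0. Qed.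

Lemma arithmetic_mean_diff (x : nat -> C) n :
  n.+1%:R * arithmetic_mean x n - n%:R * arithmetic_mean x n.-1 = x n.
Proof.
case: n => [|n] /=; rewrite arithmetic_meanE ?arithmetic_meanE.
  by rewrite mul0r subr0 seriesEnat /= big_nat1.
by rewrite /= seriesSB.
Qed.

(** The inverse of the map sending a sequence to the sequence of its means. *)
Definition cesaro_inv_seq (x : nat -> C) (n : nat) : C :=
  n.+1%:R * x n - n%:R * x n.-1.

Lemma arithmetic_mean_cesaro_inv (x : nat -> C) n :
  arithmetic_mean (cesaro_inv_seq x) n = x n.
Proof.
have n0 : n.+1%:R != 0 :> C by rewrite pnatr_eq0.
apply: (mulfI n0); rewrite arithmetic_meanE; elim: n {n0} => [|n IHn].
  by rewrite seriesEnat /= big_nat1 /cesaro_inv_seq mul0r subr0.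
by rewrite seriesSr IHn /cesaro_inv_seq subrKC.
Qed.

Lemma weight_cesaro_inv_le k l K (x : nat -> C) n :
  0 <= K -> (forall n, n.+1%:R * weight alpha k n <= K * weight alpha l n) ->
  weight alpha k n * normc (cesaro_inv_seq x n) <=
  K * (weight alpha l n * normc (x n) + weight alpha l n.-1 * normc (x n.-1)).
Proof.
move=> K0 hK; have nn m : normc (m%:R : C) = m%:R.
  by rewrite -(rmorph_nat (real_complex R)) /= expr0n addr0 sqrtr_sqr normr_nat.
apply: (@le_trans _ _ (weight alpha k n *
   (n.+1%:R * normc (x n) + n%:R * normc (x n.-1)))).
  rewrite ler_wpM2l ?weight_ge0//; apply: le_trans (le_normcD _ _) _.
  by rewrite normcN !normcM !nn.
rewrite !mulrDr lerD//.
  by rewrite mulrCA !mulrA ler_wpM2r ?normc_ge0.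
case: n => [|n] /=; first by rewrite mul0r mulr0 !mulr_ge0 ?weight_ge0 ?normc_ge0 //.
rewrite mulrCA !mulrA ler_wpM2r ?normc_ge0//; apply: le_trans (hK n).
by rewrite ler_wpM2l// weight_homo.
Qed.

(** The inverse of the Cesaro operator sends the [n]-th unit vector to a sequence
    whose [n]-th term is [n + 1], so its continuity bounds [n + 1] by a quotient
    of weights.  At [lambda = 0] the resolvent is the opposite of that inverse,
    whence the signs. *)
Lemma resolvent_weight_growth :
  resolvent_set (cesaro_op ha) 0 -> weight_growth alpha.
Proof.
case=> S [cS _ CS] k k0.
have [l [K [l0 K0 hK]]] := (continuous_linearP S).1 cS k k0.
exists (maxn k.+1 l), K; split; rewrite ?leq_max ?leqnn// => n.
have CSn i : arithmetic_mean (S (unit_vector alpha n)) i = - (i == n)%:R.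
  have /(congr1 (fun x : L => - (x i))) := CS (unit_vector alpha n).
  by rewrite scale0r sub0r opprK.
have Sn : S (unit_vector alpha n) n = - n.+1%:R.
  rewrite -[LHS]arithmetic_mean_diff !CSn eqxx mulrN1.
  by case: n {CSn} => [|n]; rewrite ?mul0r ?subr0// ltn_eqF// oppr0 mulr0 subr0.
have := Lambda0_norm_ub (S (unit_vector alpha n)) n k0.
rewrite Sn normcN -(rmorph_nat (real_complex R)) /= expr0n addr0 sqrtr_sqr.
rewrite normr_nat mulrC => /le_trans; apply; apply: le_trans (hK _) _.
rewrite Lambda0_norm_unit_vector// ler_wpM2l ?(ltW K0)//.
by rewrite weight_le// leq_max leqnn orbT.
Qed.

Lemma weight_growth_resolvent :
  weight_growth alpha -> resolvent_set (cesaro_op ha) 0.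
Proof.
move=> hg.
have mem (x : L) : (fun n => - cesaro_inv_seq x n) \in Lambda0_pred alpha.
  apply/asboolP => k k0; have [l [K [kl K0 hK]]] := hg k k0.
  apply: (@squeeze_cvgr _ _ _ _ (fun=> 0) (fun n => K *
    (weight alpha l n * normc (x n) + weight alpha l n.-1 * normc (x n.-1)))).
  - apply: nearW => n; rewrite mulr_ge0 ?weight_ge0 ?normc_ge0//= normcN.
    exact: weight_cesaro_inv_le (ltW K0) hK.
  - exact: cvg_cst.
  - have cx := Lambda0P x (leq_trans k0 (ltnW kl)).
    rewrite -(mulr0 K) -[X in K * X]addr0; apply: cvgMr; apply: cvgD => //.
    by rewrite -(cvg_shiftS (fun n => weight alpha l n.-1 * normc (x n.-1))).
pose S (x : L) := MkLambda0 (mem x).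
have Slin : linear S.
  move=> a x y; apply/val_inj/funext => n.
  change (- (n.+1%:R * (a * x n + y n) - n%:R * (a * x n.-1 + y n.-1)) =
    a * - cesaro_inv_seq x n + - cesaro_inv_seq y n).
  by rewrite /cesaro_inv_seq; ring.
pose Sl : {linear L -> L} := HB.pack S (GRing.isLinear.Build C L L _ S Slin).
exists Sl; split.
- apply/continuous_linearP => k k0; have [l [K [kl K0 hK]]] := hg k k0.
  have l0 := leq_trans k0 (ltnW kl).
  exists l, (K *+ 2); split; rewrite ?pmulrn_lgt0// => x.
  apply: Lambda0_norm_le => n; rewrite /= normcN.
  apply: le_trans (weight_cesaro_inv_le _ _ (ltW K0) hK) _.
  by rewrite mulrnAl -mulrnAr ler_wpM2l ?(ltW K0)// mulr2n lerD// Lambda0_norm_ub.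
- move=> x; apply/val_inj/funext => n; rewrite scale0r sub0r.
  change (- cesaro_inv_seq (fun i => - arithmetic_mean x i) n = x n).
  by rewrite -[RHS]arithmetic_mean_diff /cesaro_inv_seq; ring.
- move=> x; apply/val_inj/funext => n; rewrite scale0r sub0r.
  change (- arithmetic_mean (fun i => - cesaro_inv_seq x i) n = x n).
  rewrite -[RHS]arithmetic_mean_cesaro_inv /arithmetic_mean /= -mulrN.
  by rewrite seriesN opprK.
Qed.

End Operators.

(** * Nuclearity *)

Section Nuclear.
Variables (R : realType) (alpha : nat -> R).
Hypothesis ha : increasing_to_infty alpha.
Local Notation C := (R[i]).
Local Notation L := (Lambda0 alpha).
Local Notation weight := (weight alpha).

(** Two applications of the growth condition gain a factor [(n + 1) ^ 2], which
    is summable. *)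
Lemma weight_growth_summable : weight_growth alpha -> forall k, (0 < k)%N ->
  exists l, (k < l)%N /\ cvgn (series (fun n => weight k n / weight l n)).
Proof.
move=> hg k k0; have [l [K [kl K0 hK]]] := hg k k0.
have [m [M [lm M0 hM]]] := hg l (leq_trans k0 (ltnW kl)).
exists m; split; first exact: ltn_trans lm.
apply: (@series_le_cvg _ _ (fun n => K * M * (n.+1%:R ^+ 2)^-1)).
- by move=> n; rewrite divr_ge0 ?weight_ge0.
- by move=> n; rewrite !mulr_ge0 ?(ltW K0) ?(ltW M0) ?invr_ge0 ?exprn_ge0.
- move=> n; rewrite ler_pdivrMr ?weight_gt0// mulrAC ler_pdivlMr ?exprn_gt0//.
  rewrite mulrC expr2 -mulrA; apply: (@le_trans _ _ (n.+1%:R * (K * weight l n))).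
    by rewrite ler_wpM2l.
  by rewrite mulrCA -mulrA ler_wpM2l ?(ltW K0).
- by apply: is_cvg_seriesZ; exact: series_inv_sqr_cvg.
Qed.

(** With [p] dominated by [K] times the [k]-th norm and [q] equal to [K] times the
    [l]-th norm, the linking map is the extension of the expansion of [x] in unit
    vectors,
      [x = \sum_n (w_k(n) / w_l(n)) (K w_l(n) x_n) ((K w_k(n))^-1 e_n)],
    where the functionals and the vectors have been normalised. *)
Lemma weight_growth_nuclear : weight_growth alpha -> nuclear_space L.
Proof.
move=> hg p hp /(continuous_seminormP ha hp)[k [K [k0 K0 hK]]].
have [l [kl cl]] := weight_growth_summable hg k0.
have l0 := leq_trans k0 (ltnW kl).
have hl := Lambda0_norm_seminorm alpha l0.
pose q (x : L) := K * Lambda0_norm l x.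
have hq : seminorm q.
  split=> [x y|a x]; rewrite /q; first by rewrite -mulrDr ler_wpM2l ?(ltW K0)// Lambda0_normD.
  by rewrite (seminormZ hl) mulrCA.
have pq x : p x <= q x.
  apply: le_trans (hK x) _.
  by rewrite ler_wpM2l ?(ltW K0)// Lambda0_norm_homo// ltnW.
exists q; split => //.
  by apply/(continuous_seminormP ha hq); exists l, K.
have [Xp] := localBanach_exists hp; have [Xq] := localBanach_exists hq.
have [||T [Tm Tle]] := localBanach_extension Xq (f := localBanach_map Xp).
- exact: cauchy_cvg.
- by move=> x; rewrite localBanach_norm lecR.
exists Xp, Xq, T; split => //; first exact: contraction_continuous.
pose mp := localBanach_map Xp; pose mq := localBanach_map Xq.
have wk n : weight k n != 0 by rewrite lt0r_neq0 ?weight_gt0.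
have wl n : weight l n != 0 by rewrite lt0r_neq0 ?weight_gt0.
pose a n : C := (K * weight l n)%:C.
have [f hf] : {f : nat -> {linear Xq -> C^o} & forall n,
    (forall x, f n (mq x) = a n * x n) /\ (forall y, `|f n y| <= `|y|)}.
  apply: (@choice _ _ (fun n (f : {linear Xq -> C^o}) =>
    (forall x, f (mq x) = a n * x n) /\ (forall y, `|f y| <= `|y|))) => n.
  apply: (localBanach_extension Xq (f := scaled_coordinate (a n) n)) => [|x].
    exact: complex_complete.
  rewrite normcE lecR normcM normc_real; last first.
    by rewrite mulr_ge0 ?weight_ge0 ?(ltW K0).
  by rewrite -mulrA ler_wpM2l ?(ltW K0)// Lambda0_norm_ub.
pose c n : C := (weight k n / weight l n)%:C.
have nc n : normc (c n) = weight k n / weight l n.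
  by rewrite normc_real// divr_ge0 ?weight_ge0.
pose y n := (K * weight k n)^-1%:C *: mp (unit_vector alpha n).
have ny n : `|y n| <= 1.
  have Kw0 : 0 < K * weight k n by rewrite mulr_gt0 ?weight_gt0.
  rewrite normrZ normcE localBanach_norm -rmorphM lecR.
  rewrite normc_real ?invr_ge0 ?(ltW Kw0)// ler_pdivrMl// mulr1.
  by apply: le_trans (hK _) _; rewrite Lambda0_norm_unit_vector.
exists c, f, y; split => //; first by under eq_fun do rewrite nc.
  by move=> n z; have [] := hf n.
(* The partial sums [S N] are uniformly bounded operators on [Xq], so it is
   enough that they converge to [T] on the dense image of [L]. *)
pose S N z := series (fun i => (c i * f i z) *: y i) N.
have Sm N x : S N (mq x) = mp (\sum_(i < N) x i *: unit_vector alpha i).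
  rewrite /S seriesEord linear_sum; apply: eq_bigr => i _ /=.
  rewrite (hf i).1 [RHS]linearZ /y scalerA; congr (_ *: _).
  rewrite /c /a mulrA mulrAC -!rmorphM.
  rewrite (_ : _ / _ * _ * _ = 1) ?mul1r//.
  by field; rewrite wk wl lt0r_neq0.
have SB N z w : S N (z - w) = S N z - S N w.
  rewrite /S !seriesEord /= -sumrB; apply: eq_bigr => i _.
  by rewrite linearB /= mulrBr scalerBl.
have nd : nondecreasing_seq (series (fun n => weight k n / weight l n)).
  apply/nondecreasing_seqP => n; rewrite seriesSr lerDl.
  by rewrite divr_ge0 ?weight_ge0.
pose B := limn (series (fun n => weight k n / weight l n)).
have Sle N z : `|S N z| <= B%:C * `|z|.
  rewrite /S seriesEord; apply: le_trans (ler_norm_sum _ _ _) _.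
  apply: (@le_trans _ _ (\sum_(i < N) (weight k i / weight l i)%:C * `|z|)).
    apply: ler_sum => i _; rewrite normrZ normrM normcE nc -mulrA.
    rewrite ler_wpM2l ?ler0c ?divr_ge0 ?weight_ge0//.
    rewrite -[leRHS]mulr1 ler_pM//; by have [] := hf i.
  rewrite -mulr_suml -rmorph_sum ler_wpM2r// lecR.
  by apply: le_trans (nondecreasing_cvgn_le nd cl N); rewrite seriesEord.
have B0 : 0 <= B.
  by apply: le_trans (nondecreasing_cvgn_le nd cl 0%N); rewrite seriesEord /= big_ord0.
move=> z; apply/cvgrPdist_lt => e /gt0_complexP[d d0 ->].
(* [B + 3]: one share of the error for [T (z - mq x)], one for [x], and [B] shares,
   rounded up to [B + 1], for [S n (mq x - z)]. *)
have D0 : 0 < B + 3 by lra.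
have e0 : 0 < d / (B + 3) by rewrite divr_gt0.
have [|x hx] := @dense_approx _ _ _ mq (@localBanach_dense _ _ _ Xq) z (d / (B + 3))%:C.
  by rewrite ltcR.
have /cvgrPdist_lt/(_ (d / (B + 3) / K))[|N _ hN] := unit_vector_expansion_cvg x k0.
  by rewrite divr_gt0.
exists N => // n /= Nn.
have := hN n Nn; rewrite sub0r normrN ger0_norm ?Lambda0_norm_ge0//.
rewrite ltr_pdivlMr// mulrC => hn.
have -> : T z - S n z = T (z - mq x) + (mp x - S n (mq x)) + S n (mq x - z).
  by rewrite linearB /= Tm SB !addrA subrK subrK.
have -> : d%:C = (d / (B + 3))%:C + (d / (B + 3))%:C + (B + 1)%:C * (d / (B + 3))%:C.
  by rewrite -!rmorphM -!rmorphD; congr (_%:C); field; lra.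
apply: le_lt_trans (ler_normD _ _) _; apply: ltr_leD.
  apply: le_lt_trans (ler_normD _ _) _; apply: ltrD.
    by apply: le_lt_trans (Tle _) _; rewrite distrC.
  rewrite Sm -linearB localBanach_norm ltcR.
  exact: le_lt_trans (hK _) _.
apply: le_trans (Sle _ _) _; apply: ler_pM => //.
- by rewrite ler0c.
- by rewrite lecR lerDl.
- exact: ltW.
Qed.

Lemma weight_ratio_homo k l m n : (0 < k)%N -> (k <= l)%N -> (m <= n)%N ->
  weight k n / weight l n <= weight k m / weight l m.
Proof.
move=> k0 kl mn; rewrite /weight -!expRN -!expRD ler_expR.
have am : alpha m <= alpha n.
  have [_ inc _] := ha; suff nd : nondecreasing_seq alpha by exact: nd.
  by apply/nondecreasing_seqP => i; exact: ltW.
have kl' : l%:R^-1 <= k%:R^-1 :> R.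
  by rewrite lef_pV2 ?posrE ?ltr0n ?ler_nat// (leq_trans k0).
nra.
Qed.

(** A trace estimate.  The diagonal entry of the linking map at [n], computed with
    the [n]-th coordinate functional of the target and the [n]-th unit vector
    divided by [w_l(n)], is [w_k(n) / w_l(n)].  In the nuclear expansion the
    first [N] diagonal entries of the rank one term [c_i f_i y_i] add up to
    [c_i] times the value of [f_i] at one vector [x_i]; its coefficients at the
    normalised unit vectors are coordinates of [y_i], so its [l]-th norm is at most
    [1], and the bound [|c_i| K] does not depend on [N]. *)
Lemma nuclear_summable : nuclear_space L -> forall k, (0 < k)%N ->
  exists l B, (k < l)%N /\ forall N, \sum_(i < N) weight k i / weight l i <= B.
Proof.
move=> hL k k0; have hk := Lambda0_norm_seminorm alpha k0.
have [q [hq cq kq [Xp [Xq [T [_ Tm [c [f [y [cc fle yle Ty]]]]]]]]]] :=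
  hL _ hk (Lambda0_norm_continuous ha k0).
have [l0 [K [l00 K0 hK]]] := (continuous_seminormP ha hq).1 cq.
pose l := maxn k.+1 l0.
have l_gt0 : (0 < l)%N by rewrite leq_max.
have hKl x : q x <= K * Lambda0_norm l x.
  apply: le_trans (hK x) _; rewrite ler_wpM2l ?(ltW K0)//.
  by rewrite Lambda0_norm_homo// leq_maxr.
pose mp := localBanach_map Xp; pose mq := localBanach_map Xq.
pose w n : C := (weight k n)%:C.
have [g hg] : {g : nat -> {linear Xp -> C^o} & forall n,
    (forall x, g n (mp x) = w n * x n) /\ (forall z, `|g n z| <= `|z|)}.
  apply: (@choice _ _ (fun n (g : {linear Xp -> C^o}) =>
    (forall x, g (mp x) = w n * x n) /\ (forall z, `|g z| <= `|z|))) => n.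
  apply: (localBanach_extension Xp (f := scaled_coordinate (w n) n)) => [|x].
    exact: complex_complete.
  rewrite normcE lecR normcM normc_real ?weight_ge0//.
  exact: Lambda0_norm_ub.
pose A := limn (series (fun i => normc (c i))).
have Ale N : series (fun i => normc (c i)) N <= A.
  apply: nondecreasing_cvgn_le => //.
  by apply/nondecreasing_seqP => n; rewrite seriesSr lerDl normc_ge0.
exists l, (A * K); split; first by rewrite leq_maxl.
move=> N; set s := \sum_(i < N) _.
have s0 : 0 <= s by apply: sumr_ge0 => i _; rewrite divr_ge0 ?weight_ge0.
pose v n : C := (weight l n)^-1%:C.
(* [U M] is the truncated trace of the first [M] rank one terms; it tends to
   [s] as [M] grows. *)
pose U M : C^o := \sum_(n < N) v n * g n
  (series (fun i => (c i * f i (mq (unit_vector alpha n))) *: y i) M).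
have Ucvg : U @ \oo --> (s%:C : C^o).
  have -> : s%:C = \sum_(n < N) v n * g n (T (mq (unit_vector alpha n))) :> C^o.
    rewrite /s rmorph_sum; apply: eq_bigr => i _.
    by rewrite Tm (hg i).1 unit_vectorE eqxx mulr1 mulrC rmorphM.
  apply: cvg_big => [|n _]; first exact: add_continuous.
  apply: cvgMr.
  apply: continuous_cvg; last exact: Ty.
  by apply: contraction_continuous; have [] := hg n.
have Ule M : `|U M| <= (A * K)%:C.
  pose x i : L := \sum_(n < N) (v n * g n (y i)) *: unit_vector alpha n.
  have -> : U M = \sum_(i < M) c i * f i (mq (x i)) :> C^o.
    rewrite /U; under eq_bigr => n _ do
      rewrite seriesEord linear_sum mulr_sumr.
    rewrite exchange_big /=; apply: eq_bigr => i _.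
    rewrite !linear_sum mulr_sumr; apply: eq_bigr => n _ /=.
    rewrite !linearZ /=; rewrite -![_ *: (_ : C^o)]/(_ * _); ring.
  have hx i : Lambda0_norm l (x i) <= 1.
    apply: (@Lambda0_norm_sum_le R alpha l (fun n => v n * g n (y i))) => // n _.
    rewrite normcM normc_real ?invr_ge0 ?weight_ge0//.
    rewrite mulrA divff ?lt0r_neq0 ?weight_gt0// mul1r -lecR.
    exact: le_trans ((hg n).2 _) (yle i).
  apply: le_trans (ler_norm_sum _ _ _) _.
  apply: (@le_trans _ _ (\sum_(i < M) (normc (c i) * K)%:C)).
    apply: ler_sum => i _; rewrite normrM rmorphM ler_wpM2l//.
    apply: le_trans (fle _ _) _; rewrite localBanach_norm lecR.
    apply: le_trans (hKl _) _.
    by rewrite -[leRHS]mulr1 ler_wpM2l ?(ltW K0).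
  rewrite -rmorph_sum lecR -mulr_suml ler_wpM2r ?(ltW K0)//.
  by apply: le_trans (Ale M); rewrite seriesEord.
apply/ler_addgt0Pr => e e0.
have /cvgrPdist_lt/(_ e%:C) := Ucvg.
rewrite ltcR => /(_ e0)[M _ /(_ M (leqnn M))] hM.
rewrite -(normc_real s0) -lecR -normcE rmorphD -[X in `|X|](subrKC (U M)).
by apply: le_trans (ler_normD _ _) _; rewrite lerD// ltW.
Qed.

(** The quotients of weights decrease in [n], so the [n + 1] first ones dominate
    [n + 1] times the last one. *)
Lemma nuclear_weight_growth : nuclear_space L -> weight_growth alpha.
Proof.
move=> hL k k0; have [l [B [kl hB]]] := nuclear_summable hL k0.
have l0 := leq_trans k0 (ltnW kl).
exists l, (Num.max B 1); split; rewrite ?lt_max ?ltr01 ?orbT// => n.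
rewrite -ler_pdivrMr ?weight_gt0// le_max; apply/orP; left.
apply: le_trans (hB n.+1); rewrite -mulrA mulr_natl -[n.+1 in leLHS]card_ord.
rewrite -sumr_const; apply: ler_sum => i _.
by apply: weight_ratio_homo => //; [exact: ltnW|rewrite -ltnS].
Qed.

End Nuclear.

Theorem proposition2p9 (R : realType) (alpha : nat -> R)
    (halpha : increasing_to_infty alpha) :
  [<-> ~ spectrum (cesaro_op halpha) 0;
       forall k : nat, (0 < k)%N ->
         exists l : nat, (k < l)%N /\
           (ereal_sup (range (fun n : nat =>
              (ln n.+1%:R - (k%:R^-1 - l%:R^-1) * alpha n)%:E)) < +oo)%E;
       nuclear_space (Lambda0 alpha)].
Proof.
have cesaroP : resolvent_set (cesaro_op halpha) 0 <-> weight_growth alpha.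
  by split; [exact: resolvent_weight_growth|exact: weight_growth_resolvent].
have spectrumP : ~ spectrum (cesaro_op halpha) 0 <-> log_growth alpha.
  rewrite log_growthP -cesaroP; split=> [/contrapT //|h]; exact.
have nuclearP : log_growth alpha <-> nuclear_space (Lambda0 alpha).
  rewrite log_growthP; split; first exact: weight_growth_nuclear.
  exact: nuclear_weight_growth.
split; first exact: spectrumP.1.
split; first exact: nuclearP.1.
by move=> /nuclearP /spectrumP.
Qed.
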